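(* Fix $T>0$. Let $q_\varepsilon$ satisfy $$q_\varepsilon''(t)=-\frac1\varepsilon V'\!\left(\frac{q_\varepsilon(t)}{\varepsilon}\right),\quad t\in\mathbb{R},$$ with $q_\varepsilon(0)=q_a$, $q_\varepsilon(T)=q_b$ and $$\frac12|q_\varepsilon'(t)|^2+V(q_\varepsilon(t)/\varepsilon)=E_\varepsilon\quad\text{for }t\in\mathbb{R},$$ for some $E_\varepsilon>0$. Then any convergent subsequence $q_\varepsilon$, with $E_\varepsilon\to\bar E$ for some $\bar E>0$, converges uniformly as $\varepsilon\to0$ to $q$ defined by $$q(t)=\frac{t}{\sigma(\bar E)}+q_a\quad\text{for }t\in\mathbb{R}.$$
   Context: $V\in C^2(\mathbb{R})$ is $1$-periodic with $\max V=0$, and $\varepsilon>0$ is a parameter tending to $0$. The functions $q_\varepsilon\colon\mathbb{R}\to\mathbb{R}$ are taken, without loss of generality, with $q_\varepsilon'>0$ and $q_a<q_b$, where $q_a,q_b\in\mathbb{R}$ are fixed. For $E>0$, $$\sigma(E):=\int_0^1\frac{1}{\sqrt{2(E-V(\gamma))}}\,d\gamma.$$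
   Formalization: ''Converges uniformly'' is taken as uniform convergence on every bounded set of t, since uniform convergence on all of ℝ fails: for nonconstant V, E_ε generally differs from Ē, so q_ε drifts linearly away from q. *)

(* Defs.v *)
From Stdlib Require Import Reals.
From Coquelicot Require Import Coquelicot.
Local Open Scope R_scope.

(** [Derive] is total, so [ex_derive (Derive f) x] alone would not give
    differentiability of [f]; both are required in the next two definitions. *)
Definition twice_derivable (f : R -> R) : Prop :=
  forall x : R, ex_derive f x /\ ex_derive (Derive f) x.

Definition C2 (f : R -> R) : Prop :=
  twice_derivable f /\ forall x : R, continuous (Derive (Derive f)) x.

Definition one_periodic (f : R -> R) : Prop :=
  forall x : R, f (x + 1) = f x.

Definition is_max_value (f : R -> R) (m : R) : Prop :=
  (exists x : R, f x = m) /\ forall x : R, f x <= m.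

Definition sigma_int (V : R -> R) (E : R) : R :=
  RInt (fun g : R => 1 / sqrt (2 * (E - V g))) 0 1.

(** An increasing solution on the whole line, at scale [eps] and with energy
    [E > 0], that joins [qa] at time [0] to [qb] at time [T]. *)
Record connecting_solution (V : R -> R) (qa qb T eps E : R) (q : R -> R) : Prop := {
  cs_derivable : twice_derivable q;
  cs_newton : forall t : R, Derive (Derive q) t = - (1 / eps) * Derive V (q t / eps);
  cs_start : q 0 = qa;
  cs_end : q T = qb;
  cs_energy_pos : 0 < E;
  cs_energy : forall t : R, 1 / 2 * (Rabs (Derive q t)) ^ 2 + V (q t / eps) = E;
  cs_increasing : forall t : R, 0 < Derive q t
}.

(** Uniform convergence on every bounded set. It cannot be strengthened to
    uniform convergence on [R] in the homogenization limit: the energies [E eps]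
    generally differ from their limit, so the mean speeds [1 / sigma_int V (E eps)]
    and [1 / sigma_int V Ebar] differ, and the solutions drift away linearly in time
    from the limit line. [CVU f g x r] is Stdlib's uniform convergence of [f] to
    [g] on the ball of centre [x] and radius [r]. *)
Definition loc_unif_cv (f : nat -> R -> R) (g : R -> R) : Prop :=
  forall r : posreal, CVU f g 0 r.

(* Main.v *)
Require Import Defs.
From Stdlib Require Import Reals ZArith Lra Lia.
From Coquelicot Require Import Coquelicot.
Local Open Scope R_scope.

(** Conservation of energy makes the time needed to travel from [qa] to [q t]
    an explicit integral. Write [f_E g = 1 / sqrt (2 * (E - V g))] for the
    slowness at the fast position [g], and [F_E x] for its integral from [0] to
    [x]. Since [q' > 0], the energy identity says [q' = 1 / f_E (q / eps)], so
    [eps * F_E (q t / eps) - t] is constant in [t] ([travel_time]).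

    The slowness is 1-periodic, hence [F_E] is a nondecreasing function with
    [F_E (x + 1) = F_E x + sigma E], and such a function stays within [sigma E]
    of the line of slope [sigma E] ([quasi_linear]). Multiplying by [eps] and
    dividing by [sigma E], the solution satisfies, for every [t],
    [|q t - (t / sigma E + qa)| <= eps] ([solution_near_line]).

    It remains to replace [sigma (E eps)] by [sigma Ebar]. As [V <= 0], the
    slowness is Lipschitz in [E] on every half-line [E >= c > 0], uniformly in
    the position; so is [sigma] ([sigma_int_lipschitz]). On [|t| < r] the lines
    [t / sigma (E eps) + qa] therefore converge uniformly to the limit. *)

(** * Nondecreasing functions with a periodic increment *)

Lemma increment_INR (F : R -> R) (s : R) (n : nat) :
  (forall x, F (x + 1) = F x + s) ->
  forall x, F (x + INR n) = F x + INR n * s.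
Proof.
  intros HF; induction n as [|n IH]; intros x.
  - simpl; rewrite Rplus_0_r; ring.
  - rewrite S_INR, <- Rplus_assoc, HF, IH; ring.
Qed.

Lemma increment_IZR (F : R -> R) (s : R) (k : Z) :
  (forall x, F (x + 1) = F x + s) ->
  forall x, F (x + IZR k) = F x + IZR k * s.
Proof.
  intros HF x; destruct (Z_le_gt_dec 0 k) as [Hk|Hk].
  - rewrite <- (Z2Nat.id k Hk), <- INR_IZR_INZ; now apply increment_INR.
  - (* for negative [k], step back up from [x + k] to [x] *)
    assert (Hk' : (0 <= - k)%Z) by lia.
    pose proof (increment_INR F s (Z.to_nat (- k)) HF (x + IZR k)) as H.
    rewrite INR_IZR_INZ, Z2Nat.id, opp_IZR in H by exact Hk'.
    replace (x + IZR k + - IZR k) with x in H by ring.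
    lra.
Qed.

(** A nondecreasing function that grows by [s] over each unit step stays within
    [s] of linear growth. *)
Lemma quasi_linear (F : R -> R) (s : R) :
  (forall x y, x <= y -> F x <= F y) ->
  (forall x, F (x + 1) = F x + s) ->
  forall x y, Rabs (F x - F y - s * (x - y)) <= s.
Proof.
  intros Hmono HF x y.
  assert (Hs : 0 <= s).
  { pose proof (HF 0); pose proof (Hmono 0 (0 + 1)); lra. }
  (* with [k <= x - y <= k + 1], compare [x] with [y + k] and [y + (k + 1)] *)
  destruct (base_Int_part (x - y)) as [H1 H2].
  set (k := Int_part (x - y)) in *.
  pose proof (Hmono (y + IZR k) x ltac:(lra)) as Hlo.
  pose proof (Hmono x (y + IZR k + 1) ltac:(lra)) as Hhi.
  rewrite HF in Hhi.
  rewrite (increment_IZR F s k HF) in Hlo, Hhi.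
  pose proof (Rmult_le_compat_l s _ _ Hs H1).
  pose proof (Rmult_le_compat_l s (x - y) (IZR k + 1) Hs ltac:(lra)).
  apply Rabs_le; lra.
Qed.

(** * The slowness and its integral *)

(** The reciprocal of the speed, at energy [E] and fast position [g]. *)
Definition slowness (V : R -> R) (E g : R) : R := 1 / sqrt (2 * (E - V g)).

(** The time needed, at scale 1, to go from [0] to [x] with energy [E]. *)
Definition travel (V : R -> R) (E x : R) : R := RInt (slowness V E) 0 x.

Lemma slowness_pos (V : R -> R) (E g : R) : V g < E -> 0 < slowness V E g.
Proof.
  intros H; unfold slowness.
  apply Rdiv_lt_0_compat; [lra | apply sqrt_lt_R0; lra].
Qed.

Lemma continuous_slowness (V : R -> R) (E g : R) :
  continuous V g -> V g < E -> continuous (slowness V E) g.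
Proof.
  intros HV H; unfold slowness.
  apply (continuous_ext (fun g => scal 1 (/ sqrt (2 * (E - V g))))).
  { intros x; unfold scal; simpl; unfold mult; simpl; unfold Rdiv; ring. }
  apply (continuous_scal_r 1 (fun g => / sqrt (2 * (E - V g)))).
  apply (continuous_comp (fun g => sqrt (2 * (E - V g))) Rinv).
  - apply (continuous_comp (fun g => 2 * (E - V g)) sqrt).
    + apply (continuous_scal_r 2 (fun g => E - V g)).
      apply (continuous_minus (fun _ => E) V); [apply continuous_const | exact HV].
    + apply continuous_sqrt.
  - apply continuous_Rinv.
    apply Rgt_not_eq, sqrt_lt_R0; lra.
Qed.

Section BelowEnergy.
Variables (V : R -> R) (E : R).
Hypothesis V_cont : forall x, continuous V x.
Hypothesis V_lt : forall x, V x < E.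

Lemma ex_RInt_slowness (a b : R) : ex_RInt (slowness V E) a b.
Proof.
  apply (ex_RInt_continuous (V := R_CompleteNormedModule)).
  intros z _; apply continuous_slowness; auto.
Qed.

Lemma sigma_int_pos : 0 < sigma_int V E.
Proof.
  apply (RInt_gt_0 (slowness V E)); [lra | |].
  - intros x _; apply slowness_pos; auto.
  - intros x _; apply continuous_slowness; auto.
Qed.

Lemma is_derive_travel (x : R) : is_derive (travel V E) x (slowness V E x).
Proof.
  apply (is_derive_RInt (slowness V E) (travel V E) 0 x).
  - apply filter_forall; intros y.
    apply (RInt_correct (V := R_CompleteNormedModule)), ex_RInt_slowness.
  - apply continuous_slowness; auto.
Qed.

Lemma travel_nondecreasing (x y : R) : x <= y -> travel V E x <= travel V E y.
Proof.
  intros Hxy; unfold travel.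
  rewrite <- (RInt_Chasles (slowness V E) 0 x y) by apply ex_RInt_slowness.
  assert (0 <= RInt (slowness V E) x y).
  { apply RInt_ge_0; [exact Hxy | apply ex_RInt_slowness |].
    intros z _; apply Rlt_le, slowness_pos; auto. }
  unfold plus; simpl; lra.
Qed.

Lemma travel_period (x : R) :
  one_periodic V -> travel V E (x + 1) = travel V E x + sigma_int V E.
Proof.
  intros Hper; unfold travel.
  rewrite <- (RInt_Chasles (slowness V E) 0 1 (x + 1)) by apply ex_RInt_slowness.
  assert (Hshift : RInt (slowness V E) 1 (x + 1) = RInt (slowness V E) 0 x).
  { replace 1 with (1 * 0 + 1) at 1 by ring.
    replace (x + 1) with (1 * x + 1) by ring.
    rewrite <- (RInt_comp_lin (slowness V E) 1 1 0 x) by apply ex_RInt_slowness.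
    apply RInt_ext; intros z _.
    unfold scal; simpl; unfold mult; simpl; unfold slowness.
    rewrite !Rmult_1_l, Hper; reflexivity. }
  rewrite Hshift; unfold plus; simpl.
  change (sigma_int V E) with (RInt (slowness V E) 0 1); ring.
Qed.

End BelowEnergy.

(** * Dependence of the mean slowness on the energy *)

Lemma slowness_lipschitz (V : R -> R) (c E E' g : R) :
  0 < c -> V g <= 0 -> c <= E -> c <= E' ->
  Rabs (slowness V E g - slowness V E' g) <= Rabs (E - E') / sqrt (2 * c) ^ 3.
Proof.
  intros Hc HV HE HE'; unfold slowness.
  assert (Hs : 0 < sqrt (2 * c)) by (apply sqrt_lt_R0; lra).
  assert (Ha : sqrt (2 * c) <= sqrt (2 * (E - V g))) by (apply sqrt_le_1; lra).
  assert (Hb : sqrt (2 * c) <= sqrt (2 * (E' - V g))) by (apply sqrt_le_1; lra).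
  pose proof (sqrt_sqrt (2 * (E - V g)) ltac:(lra)) as Haa.
  pose proof (sqrt_sqrt (2 * (E' - V g)) ltac:(lra)) as Hbb.
  set (s := sqrt (2 * c)) in *.
  set (a := sqrt (2 * (E - V g))) in *.
  set (b := sqrt (2 * (E' - V g))) in *.
  replace (1 / a - 1 / b) with (- (2 * (E - E')) / (a * b * (a + b))).
  2:{ replace (2 * (E - E')) with (a * a - b * b) by lra. field. repeat split; lra. }
  assert (Hab : s * s <= a * b) by (apply Rmult_le_compat; lra).
  assert (Hden : 2 * s ^ 3 <= a * b * (a + b)).
  { replace (2 * s ^ 3) with (s * s * (2 * s)) by ring.
    apply Rmult_le_compat; nra. }
  assert (Hs3 : 0 < s ^ 3) by (apply pow_lt; exact Hs).
  unfold Rdiv.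
  rewrite Rabs_mult, Rabs_Ropp, Rabs_mult, (Rabs_pos_eq 2) by lra.
  rewrite (Rabs_pos_eq (/ _)) by (apply Rlt_le, Rinv_0_lt_compat; lra).
  replace (Rabs (E - E') * / s ^ 3) with (2 * Rabs (E - E') * / (2 * s ^ 3))
    by (field; lra).
  apply Rmult_le_compat_l.
  - pose proof (Rabs_pos (E - E')); lra.
  - apply Rinv_le_contravar; lra.
Qed.

Lemma sigma_int_lipschitz (V : R -> R) (c E E' : R) :
  (forall x, continuous V x) -> (forall x, V x <= 0) ->
  0 < c -> c <= E -> c <= E' ->
  Rabs (sigma_int V E - sigma_int V E') <= Rabs (E - E') / sqrt (2 * c) ^ 3.
Proof.
  intros Hcont HV Hc HE HE'.
  assert (HI : forall e, c <= e -> ex_RInt (slowness V e) 0 1).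
  { intros e He; apply ex_RInt_slowness; auto.
    intros x; specialize (HV x); lra. }
  change (Rabs (minus (RInt (slowness V E) 0 1) (RInt (slowness V E') 0 1))
    <= Rabs (E - E') / sqrt (2 * c) ^ 3).
  rewrite <- (RInt_minus (V := R_CompleteNormedModule)) by auto.
  replace (Rabs (E - E') / sqrt (2 * c) ^ 3)
    with ((1 - 0) * (Rabs (E - E') / sqrt (2 * c) ^ 3)) by ring.
  apply abs_RInt_le_const; [lra | |].
  - apply (ex_RInt_minus (V := R_CompleteNormedModule)); auto.
  - intros t _; apply slowness_lipschitz; auto.
Qed.

Lemma is_lim_seq_sigma_int (V : R -> R) (e : nat -> R) (Ebar : R) :
  (forall x, continuous V x) -> (forall x, V x <= 0) -> 0 < Ebar ->
  is_lim_seq e Ebar ->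
  is_lim_seq (fun n => sigma_int V (e n)) (sigma_int V Ebar).
Proof.
  intros Hcont HV HE Hlim.
  set (K := / sqrt (2 * (Ebar / 2)) ^ 3).
  assert (Hev : eventually (fun n => Ebar / 2 <= e n)).
  { apply is_lim_seq_spec in Hlim.
    assert (Hh : 0 < Ebar / 2) by lra.
    generalize (Hlim (mkposreal _ Hh)).
    apply filter_imp; intros n Hn; simpl in Hn.
    apply Rabs_lt_between in Hn; lra. }
  assert (Hdist : is_lim_seq (fun n => Rabs (e n - Ebar) * K) 0).
  { replace 0 with (Rabs (Ebar - Ebar) * K)
      by (rewrite Rminus_diag, Rabs_R0; ring).
    apply (is_lim_seq_scal_r (fun n => Rabs (e n - Ebar)) K (Finite (Rabs (Ebar - Ebar)))).
    apply (is_lim_seq_abs (fun n => e n - Ebar) (Finite (Ebar - Ebar))).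
    apply is_lim_seq_minus'; [exact Hlim | apply is_lim_seq_const]. }
  apply is_lim_seq_ext with
    (fun n => (sigma_int V (e n) - sigma_int V Ebar) + sigma_int V Ebar).
  { intros n; ring. }
  replace (Finite (sigma_int V Ebar)) with (Finite (0 + sigma_int V Ebar))
    by (f_equal; ring).
  apply is_lim_seq_plus'; [| apply is_lim_seq_const].
  apply is_lim_seq_abs_0.
  apply is_lim_seq_le_le_loc with (fun _ => 0) (fun n => Rabs (e n - Ebar) * K).
  - revert Hev; apply filter_imp; intros n Hn; split; [apply Rabs_pos |].
    apply sigma_int_lipschitz; auto; lra.
  - apply is_lim_seq_const.
  - exact Hdist.
Qed.

(** * Solutions stay close to a line *)

Section Solution.
Variables (V : R -> R) (qa qb T eps E : R) (q : R -> R).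
Hypothesis V_cont : forall x, continuous V x.
Hypothesis V_le : forall x, V x <= 0.
Hypothesis eps_pos : 0 < eps.
Hypothesis q_sol : connecting_solution V qa qb T eps E q.

Let V_lt (x : R) : V x < E.
Proof. pose proof (cs_energy_pos _ _ _ _ _ _ _ q_sol); specialize (V_le x); lra. Qed.

Lemma speed_eq (t : R) : Derive q t * slowness V E (q t / eps) = 1.
Proof.
  pose proof (cs_increasing _ _ _ _ _ _ _ q_sol t) as Hpos.
  pose proof (cs_energy _ _ _ _ _ _ _ q_sol t) as Hen.
  rewrite Rabs_pos_eq in Hen by lra.
  unfold slowness.
  replace (2 * (E - V (q t / eps))) with (Derive q t * Derive q t) by lra.
  rewrite sqrt_square by lra.
  field; lra.
Qed.

Lemma travel_time (t : R) :
  eps * (travel V E (q t / eps) - travel V E (qa / eps)) = t.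
Proof.
  set (h := fun s => eps * travel V E (q s / eps) - s).
  assert (Hd : forall s, is_derive h s 0).
  { intros s; unfold h.
    assert (Hq : is_derive q s (Derive q s)).
    { apply Derive_correct, (cs_derivable _ _ _ _ _ _ _ q_sol). }
    pose proof (is_derive_travel V E V_cont V_lt (q s / eps)) as Ht.
    assert (Hqe : is_derive (fun s => q s / eps) s (Derive q s / eps)).
    { apply (is_derive_ext (fun s => scal (/ eps) (q s))).
      { intros x; unfold scal; simpl; unfold mult; simpl; unfold Rdiv; ring. }
      replace (Derive q s / eps) with (scal (/ eps) (Derive q s))
        by (unfold scal; simpl; unfold mult; simpl; unfold Rdiv; ring).
      apply (is_derive_scal q s (/ eps) (Derive q s)); exact Hq. }
    pose proof (is_derive_comp (travel V E) (fun s => q s / eps) s _ _ Ht Hqe) as Hc.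
    pose proof (is_derive_minus _ (fun s => s) s _ _
      (is_derive_scal _ s eps _ Hc) (is_derive_id s)) as Hm.
    evar_last; [exact Hm |].
    pose proof (speed_eq s) as Hs.
    unfold minus, plus, opp, scal, one; simpl; unfold mult; simpl.
    replace (eps * (Derive q s / eps * slowness V E (q s / eps)))
      with (Derive q s * slowness V E (q s / eps)) by (field; lra).
    lra. }
  assert (Hc : h t = h 0).
  { destruct (MVT_gen h 0 t (fun _ => 0)) as [c [_ Hc]].
    - intros x _; apply Hd.
    - intros x _; apply continuity_pt_filterlim.
      apply (ex_derive_continuous h x); exists 0; apply Hd.
    - lra. }
  unfold h in Hc; rewrite (cs_start _ _ _ _ _ _ _ q_sol) in Hc; lra.
Qed.

(** The error bound is independent of the energy and of the time. *)
Lemma solution_near_line (t : R) :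
  one_periodic V -> Rabs (t / sigma_int V E + qa - q t) <= eps.
Proof.
  intros Hper.
  pose proof (sigma_int_pos V E V_cont V_lt) as Hsig.
  pose proof (quasi_linear (travel V E) (sigma_int V E)
    (travel_nondecreasing V E V_cont V_lt)
    (fun x => travel_period V E V_cont V_lt x Hper) (q t / eps) (qa / eps)) as Hql.
  pose proof (travel_time t) as Htime.
  set (d := travel V E (q t / eps) - travel V E (qa / eps)) in *.
  set (sg := sigma_int V E) in *.
  replace (t / sg + qa - q t)
    with (eps / sg * (d - sg * (q t / eps - qa / eps)))
    by (rewrite <- Htime; field; lra).
  assert (Hr : 0 < eps / sg) by (apply Rdiv_lt_0_compat; lra).
  rewrite Rabs_mult, (Rabs_pos_eq (eps / sg)) by lra.
  apply Rle_trans with (eps / sg * sg).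
  - apply Rmult_le_compat_l; lra.
  - apply Req_le; field; lra.
Qed.

End Solution.

Theorem corollary2p8 (V : R -> R) (qa qb T : R) (q : R -> R -> R) (E : R -> R)
  (V_C2 : C2 V) (V_per : one_periodic V) (V_max : is_max_value V 0)
  (qa_lt_qb : qa < qb) (T_pos : 0 < T)
  (q_sol : at_right 0 (fun eps : R =>
     connecting_solution V qa qb T eps (E eps) (q eps)))
  (eps : nat -> R) (eps_pos : forall n : nat, 0 < eps n)
  (eps_lim : is_lim_seq eps 0)
  (Ebar : R) (Ebar_pos : 0 < Ebar)
  (E_lim : is_lim_seq (fun n : nat => E (eps n)) Ebar) :
  loc_unif_cv (fun n : nat => q (eps n)) (fun t : R => t / sigma_int V Ebar + qa).
Proof.
  assert (V_cont : forall x, continuous V x).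
  { intros x; apply (ex_derive_continuous V x), (proj1 V_C2). }
  destruct V_max as [_ V_le].
  assert (Hsol : eventually (fun n =>
    connecting_solution V qa qb T (eps n) (E (eps n)) (q (eps n)))).
  { destruct q_sol as [d Hd].
    apply is_lim_seq_spec in eps_lim.
    generalize (eps_lim d); apply filter_imp; intros n Hn.
    apply Hd; [exact Hn | apply eps_pos]. }
  assert (Hsig : 0 < sigma_int V Ebar).
  { apply sigma_int_pos; auto; intros x; specialize (V_le x); lra. }
  pose proof (is_lim_seq_sigma_int V _ Ebar V_cont V_le Ebar_pos E_lim) as Hslim.
  assert (Hinv : is_lim_seq (fun n => / sigma_int V (E (eps n))) (/ sigma_int V Ebar)).
  { apply (is_lim_seq_inv _ (Finite (sigma_int V Ebar))); [exact Hslim |].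
    intros H; injection H; lra. }
  intros r e He.
  assert (He2 : 0 < e / 2) by lra.
  assert (Her : 0 < e / 2 / r) by (apply Rdiv_lt_0_compat; [lra | apply cond_pos]).
  apply is_lim_seq_spec in Hinv; apply is_lim_seq_spec in eps_lim.
  (* half of the tolerance pays for [eps n], half for the change of mean speed *)
  destruct (filter_and _ _ Hsol (filter_and _ _ (eps_lim (mkposreal _ He2))
    (Hinv (mkposreal _ Her)))) as [N HN].
  exists N; intros n y Hn Hy.
  destruct (HN n Hn) as [Hs [Hsmall Hspeed]]; simpl in Hsmall, Hspeed.
  unfold Boule in Hy; rewrite Rminus_0_r in Hy.
  rewrite Rminus_0_r, Rabs_pos_eq in Hsmall by (apply Rlt_le, eps_pos).
  pose proof (solution_near_line V qa qb T (eps n) (E (eps n)) (q (eps n))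
    V_cont V_le (eps_pos n) Hs y V_per) as Hline.
  replace (y / sigma_int V Ebar + qa - q (eps n) y)
    with ((y / sigma_int V (E (eps n)) + qa - q (eps n) y)
          - y * (/ sigma_int V (E (eps n)) - / sigma_int V Ebar))
    by (unfold Rdiv; ring).
  assert (Hdrift : Rabs (y * (/ sigma_int V (E (eps n)) - / sigma_int V Ebar)) <= e / 2).
  { rewrite Rabs_mult.
    replace (e / 2) with (r * (e / 2 / r)) by (field; apply Rgt_not_eq, cond_pos).
    apply Rmult_le_compat; try apply Rabs_pos; lra. }
  eapply Rle_lt_trans; [apply Rabs_triang |].
  rewrite Rabs_Ropp; lra.
Qed.
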